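(* Let $\mathcal{M}$ be a manifold, $\mathcal{A}$ an alphabet with a grading $|\cdot|\colon\mathcal{A}\to\mathbb{N}^+$, and $\nu\colon\mathcal{A}\to\mathcal{X}(\mathcal{M})$ a map assigning a vector field to each letter. Let $H=H_{\mathrm{Sh}}(\mathcal{A})$ be the corresponding graded shuffle Hopf algebra. Let $\alpha\in\mathfrak{g}(H)$ and $\beta=Q(\alpha)\in G(H)$, i.e. $\alpha$ and $\beta$ are related by the graded Dynkin idempotent, $\alpha=\beta\circ Y^{-1}\circ D$. Define the time-dependent vector field $$F_t=\frac{\partial}{\partial t}\mathcal{B}_t(\alpha).$$ Then the pullback of a time-independent function $\psi$ along the time-dependent flow $\Phi_{t,F_t}$ is given by $$\Phi_{t,F_t}^*\psi=\mathcal{B}_t(\beta)[\psi].$$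
   Context: Formal series convention: all series are formal and convergence is not considered; identities are identities of formal power series in $t$ (Taylor series at $t=0$). Vector fields and differential operators: $\mathcal{X}(\mathcal{M})$ is the set of vector fields on $\mathcal{M}$. A vector field $F$ acts on a function $\psi\colon\mathcal{M}\to V$ ($V$ a vector space) by the Lie derivative $F[\psi]$. Products of vector fields are composed as differential operators, $(FG)[\psi]=F[G[\psi]]$, and $\mathbb{1}[\psi]=\psi$. $U(\mathcal{X}(\mathcal{M}))$ is the linear span of all such differential operators. Flow and pullback: for a time-dependent vector field $F_t=\sum_{j\ge0}F_{j+1}\frac{t^j}{j!}$, $\Phi_{t,F_t}$ is the solution operator of $y'(t)=F_t(y(t))$, $y(0)=y_0$, i.e. $y(t)=\Phi_{t,F_t}y_0$. The pullback is $\Phi_{t,F_t}^*\psi=\psi\circ\Phi_{t,F_t}$. Understood as a formal series in $t$, it is determined by $\Phi_{0,F_0}^*\psi=\psi$ and $\frac{\partial}{\partial t}\Phi_{t,F_t}^*\psi=\Phi_{t,F_t}^*(F_t[\psi])$ for every time-independent $\psi$ (with $\Phi_{t,F_t}^*$ applied coefficientwise in $t$ to $F_t[\psi]$, i.e. at each fixed value of $t$). Shuffle Hopf algebra: $\mathcal{A}^*$ is the set of words in $\mathcal{A}$ with empty word $\mathbb{1}$. $H_{\mathrm{Sh}}(\mathcal{A})$ is the vector space $\mathbb{R}\langle\mathcal{A}\rangle$ with basis $\mathcal{A}^*$, with the shuffle product $\sqcup$ (unit $\mathbb{1}$), the deconcatenation coproduct $\Delta(\omega)=\sum_{\omega=\omega_1\omega_2}\omega_1\otimes\omega_2$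 (empty factors included), the counit $\epsilon(\mathbb{1})=1$, $\epsilon(\omega)=0$ for $\omega\neq\mathbb{1}$, and the antipode $S(a_1\cdots a_k)=(-1)^ka_k\cdots a_1$. It is graded by $|a_1\cdots a_k|=|a_1|+\cdots+|a_k|$, $|\mathbb{1}|=0$, and $H_n$ denotes the degree-$n$ part. The dual $H^*$ (all real functions on words) has convolution product $(\alpha\ast\beta)(\omega)=\sum_{\omega=\omega_1\omega_2}\alpha(\omega_1)\beta(\omega_2)$. Characters: $G(H)$ is the set of $\beta\in H^*$ with $\beta(\mathbb{1})=1$ and $\beta(\omega_1\sqcup\omega_2)=\beta(\omega_1)\beta(\omega_2)$ for all words. $\mathfrak{g}(H)$ is the set of $\alpha\in H^*$ with $\alpha(\mathbb{1})=0$ and $\alpha(\omega_1\sqcup\omega_2)=0$ for all non-empty words $\omega_1,\omega_2$. Series: $\mathcal{F}_\nu\colon\mathbb{R}\langle\mathcal{A}\rangle\to U(\mathcal{X}(\mathcal{M}))$ is the linear map with $\mathcal{F}_\nu(\mathbb{1})=\mathbb{1}$, $\mathcal{F}_\nu(a)=\nu(a)$ for letters $a$, and $\mathcal{F}_\nu(\omega_1\omega_2)=\mathcal{F}_\nu(\omega_1)\mathcal{F}_\nu(\omega_2)$. For $\alpha\in H^*$ define the formal series $$\mathcal{B}_t(\alpha)=\sum_{\omega\in\mathcal{A}^*}t^{|\omega|}\alpha(\omega)\mathcal{F}_\nu(\omega).$$ (The sum over words of a fixed degree is finite if there are finitely many letters of each degree; otherwise it is also formal.) For $\alpha\in\mathfrak{g}(H)$,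 $\mathcal{B}_t(\alpha)$ is a formal vector field. The map $Q$ and the Dynkin idempotent: let $\alpha_i$ be the restriction of $\alpha$ to $H_i$, extended by zero. Then $$Q(\alpha)=\epsilon+\sum_{n\ge1}\ \sum_{j_1+\cdots+j_l=n,\ j_i>0}\frac{j_1j_2\cdots j_l}{j_1(j_1+j_2)\cdots(j_1+\cdots+j_l)}\,\alpha_{j_1}\ast\cdots\ast\alpha_{j_l}.$$ It is a bijection $\mathfrak{g}(H)\to G(H)$ with inverse $\beta\mapsto\beta\circ Y^{-1}\circ D$. Here $Y(\omega)=|\omega|\,\omega$ is the grading operator (inverted on positive degrees), and $D=S\ast Y$ is the graded Dynkin operator, the convolution of $S$ and $Y$ in $\mathrm{End}(H)$, that is $D(\omega)=\sum_{\omega=\omega_1\omega_2}S(\omega_1)\sqcup Y(\omega_2)$. *)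

(* Defs.v *)
From HB Require Import structures.
From mathcomp Require Import all_boot all_order all_algebra finmap.
(* [monalg] has to be imported before MathComp-Analysis: in the other order
   their notation levels clash. *)
From mathcomp Require Import monalg.
From mathcomp Require Import all_classical all_reals all_analysis.

Set Implicit Arguments.
Unset Strict Implicit.
Unset Printing Implicit Defensive.

Import Order.TTheory GRing.Theory Num.Theory numFieldNormedType.Exports.
Local Open Scope classical_set_scope.
Local Open Scope ring_scope.

Section Smoothness.
Variables (R : realType) (n : nat) (V : normedModType R).

(* Only meaningful for [U] open: ['D_v f x] is the two-sided derivative in
   the whole space ['rV[R]_n]. *)
Fixpoint Ck_on (k : nat) (U : set 'rV[R]_n) (f : 'rV[R]_n -> V) : Prop :=
  if k is k'.+1 then
    (forall x, U x -> differentiable f x) /\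
    (forall i : 'I_n, Ck_on k' U (fun x => 'D_(delta_mx 0 i) f x))
  else forall x, U x -> {for x, continuous f}.

Definition smooth_on (U : set 'rV[R]_n) (f : 'rV[R]_n -> V) : Prop :=
  forall k, Ck_on k U f.

End Smoothness.

(* [chart_map] and [chart_inv] are total functions; their values outside of
   [chart_dom], resp. of its image, carry no information. *)
Record chart (R : realType) (n : nat) (T : topologicalType) := Chart {
  chart_dom : set T;
  chart_map : T -> 'rV[R]_n;
  chart_inv : 'rV[R]_n -> T;
  chart_dom_open : open chart_dom;
  chart_im_open : open (chart_map @` chart_dom);
  chart_mapK : forall x, chart_dom x -> chart_inv (chart_map x) = x;
  chart_map_continuous :
    forall x, chart_dom x -> {for x, continuous chart_map};
  chart_inv_continuous :
    forall y, (chart_map @` chart_dom) y -> {for y, continuous chart_inv}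
}.

Record manifold (R : realType) (n : nat) := Manifold {
  carrier :> topologicalType;
  carrier_hausdorff : hausdorff_space carrier;
  carrier_second_countable : @second_countable carrier;
  chart_index : Type;
  atlas : chart_index -> chart R n carrier;
  atlas_cover : forall x : carrier, exists i, chart_dom (atlas i) x;
  atlas_compat : forall i j : chart_index,
    smooth_on
      (chart_map (atlas i) @` (chart_dom (atlas i) `&` chart_dom (atlas j)))
      (chart_map (atlas j) \o chart_inv (atlas i))
}.

Section VectorFields.
Variables (R : realType) (n : nat) (M : manifold R n).
Implicit Types (i j : chart_index M) (x : M).

Definition smooth (V : normedModType R) (psi : M -> V) : Prop :=
  forall i, smooth_on (chart_map (atlas i) @` chart_dom (atlas i))
                      (psi \o chart_inv (atlas i)).

(* A smooth section of the tangent bundle, given by its components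
   [vf_coord i] in each chart [i], which transform by the differentials of
   the transition maps. *)
Record vector_field := VectorField {
  vf_coord : chart_index M -> M -> 'rV[R]_n;
  vf_smooth : forall i,
    smooth_on (chart_map (atlas i) @` chart_dom (atlas i))
              (vf_coord i \o chart_inv (atlas i));
  vf_compat : forall i j x,
    chart_dom (atlas i) x -> chart_dom (atlas j) x ->
    vf_coord j x =
      'd (chart_map (atlas j) \o chart_inv (atlas i))
         (chart_map (atlas i) x) (vf_coord i x)
}.

Definition chart_at x : chart_index M := projT1 (cid (atlas_cover x)).

(* F[psi]: by [vf_compat] and the chain rule the value at x does not depend
   on the chart around x, when psi is smooth. *)
Definition lie_derivative (V : normedModType R) (F : vector_field)
    (psi : M -> V) : M -> V :=
  fun x => let i := chart_at x in
  'D_(vf_coord F i x) (psi \o chart_inv (atlas i)) (chart_map (atlas i) x).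

End VectorFields.

Section ShuffleAlgebra.
Variables (R : realType) (A : choiceType) (deg : A -> nat).
Implicit Types (u v w : seq A) (p q : {malg R[seq A]}) (alpha beta : seq A -> R).

Definition wdeg w : nat := (\sum_(a <- w) deg a)%N.

Definition linext (W : lmodType R) (f : seq A -> W) p : W :=
  \sum_(w <- msupp p) p@_w *: f w.

(* The dual H^* is represented by functions on words. *)
Definition pairing alpha p : R := linext (alpha : seq A -> R^o) p.

(* All interleavings of u and v, with multiplicity. *)
Fixpoint shuffles u : seq A -> seq (seq A) :=
  fix shuffles_u v :=
    match u, v with
    | [::], _ => [:: v]
    | _, [::] => [:: u]
    | a :: u', b :: v' =>
        map (cons a) (shuffles u' v) ++ map (cons b) (shuffles_u v')
    end.

Definition word w : {malg R[seq A]} := mkmalgU w 1.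

Definition shuffle_word u v : {malg R[seq A]} :=
  \sum_(w <- shuffles u v) word w.

Definition shuffle p q : {malg R[seq A]} :=
  linext (fun u => linext (fun v => shuffle_word u v) q) p.

Definition counit w : R := (w == [::])%:R.

Definition antipode : {malg R[seq A]} -> {malg R[seq A]} :=
  linext (fun w => (-1) ^+ size w *: word (rev w)).

Definition grading : {malg R[seq A]} -> {malg R[seq A]} :=
  linext (fun w => (wdeg w)%:R *: word w).

(* The inverse of [grading] on positive degrees; it kills the empty word, as
   0^-1 = 0. *)
Definition grading_inv : {malg R[seq A]} -> {malg R[seq A]} :=
  linext (fun w => (wdeg w)%:R^-1 *: word w).

Definition end_conv (f g : {malg R[seq A]} -> {malg R[seq A]}) :
    {malg R[seq A]} -> {malg R[seq A]} :=
  linext (fun w => \sum_(i < (size w).+1)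
    shuffle (f (word (take i w))) (g (word (drop i w)))).

Definition dynkin_op : {malg R[seq A]} -> {malg R[seq A]} :=
  end_conv antipode grading.

Definition convolution alpha beta : seq A -> R :=
  fun w => \sum_(i < (size w).+1) alpha (take i w) * beta (drop i w).

Definition character beta : Prop :=
  beta [::] = 1 /\
  forall u v, pairing beta (shuffle_word u v) = beta u * beta v.

Definition infinitesimal_character alpha : Prop :=
  alpha [::] = 0 /\
  forall u v, u <> [::] -> v <> [::] -> pairing alpha (shuffle_word u v) = 0.

Definition restrict_deg alpha (j : nat) : seq A -> R :=
  fun w => if wdeg w == j then alpha w else 0.

(* j_1 ... j_l / (j_1 (j_1 + j_2) ... (j_1 + ... + j_l)) *)
Definition Qcoef (js : seq nat) : R :=
  (\prod_(j <- js) j%:R) / (\prod_(s <- scanl addn 0%N js) s%:R).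

(* The summand of degree n of Q(alpha): the sum over compositions
   (j_1, ..., j_l) of n. As j_i > 0, there are at most n parts, all <= n. *)
Definition Qdeg alpha (n : nat) : seq A -> R :=
  fun w => \sum_(l < n.+1)
    \sum_(js : l.-tuple 'I_n.+1 |
            all (fun j : 'I_n.+1 => 0 < j)%N js &&
            (sumn (map val js) == n))
      Qcoef (map val js) *
      foldr (fun j : 'I_n.+1 => convolution (restrict_deg alpha j)) counit js w.

(* [Qdeg alpha n] is supported in degree n, so that the sum over n >= 1 may be
   cut at n = |w| when it is evaluated at w. *)
Definition Q alpha : seq A -> R :=
  fun w => counit w + \sum_(1 <= n < (wdeg w).+1) Qdeg alpha n w.

End ShuffleAlgebra.

Section FormalSeries.
Variables (R : realType) (n : nat) (M : manifold R n) (V : normedModType R).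
Variables (A : choiceType) (deg : A -> nat) (nu : A -> vector_field M).
Implicit Types (psi : M -> V) (alpha : seq A -> R) (w : seq A).

Definition operator := (M -> V) -> (M -> V).

(* F_nu(w), acting on functions M -> V. *)
Definition word_op w : operator :=
  foldr (fun a (G : operator) => @lie_derivative R n M V (nu a) \o G) id w.

(* A formal series of operators in t is the sequence of its coefficients. *)

Definition ddt (F : nat -> operator) : nat -> operator :=
  fun m psi => m.+1%:R *: F m.+1 psi.

(* The sum of all the words of degree m is finite if there are finitely many
   letters of each degree; [\sum_(_ \in _)] is a sum of finite support. *)
Definition Bseries alpha : nat -> operator :=
  fun m psi =>
    \sum_(w \in [set w | wdeg deg w = m]) (alpha w *: word_op w psi).

(* The formal pullback along the flow of F_t = sum_m F m t^m. It is determined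
   by the equations [pullback0] and [pullbackS] below, i.e. by Phi_0^* psi = psi
   and d/dt Phi_t^* psi = Phi_t^* (F_t[psi]); [fuel] bounds the recursion. *)
Fixpoint pullback_rec (F : nat -> operator) (fuel m : nat) : operator :=
  fun psi =>
  match fuel, m with
  | fuel'.+1, m'.+1 =>
      m'.+1%:R^-1 *:
        \sum_(k < m'.+1) pullback_rec F fuel' k (F (m' - k)%N psi)
  | _, _ => psi
  end.

Definition pullback (F : nat -> operator) (m : nat) : operator :=
  pullback_rec F m m.

Lemma pullback_rec_fuel F fuel m psi :
  (m <= fuel)%N -> pullback_rec F fuel m psi = pullback F m psi.
Proof.
rewrite /pullback; elim/ltn_ind: m fuel psi => -[|m] IH [|f] psi //= mf.
congr (_ *: _); apply: eq_bigr => k _.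
have km : (k <= m)%N by rewrite -ltnS.
by rewrite [LHS]IH ?[RHS]IH // ?(leq_trans km).
Qed.

Lemma pullback0 F psi : pullback F 0 psi = psi.
Proof. by []. Qed.

Lemma pullbackS F m psi :
  m.+1%:R *: pullback F m.+1 psi =
  \sum_(k < m.+1) pullback F k (F (m - k)%N psi).
Proof.
rewrite /pullback /= scalerA divff ?pnatr_eq0 // scale1r.
by apply: eq_bigr => k _; rewrite pullback_rec_fuel // -ltnS.
Qed.

(* For an arbitrary alphabet, the words of given degree may be infinitely many
   and B_t(alpha) = sum_w t^|w| alpha(w) F_nu(w) is a formal sum over words: it
   is represented by the family of its terms, the term indexed by w being the
   coefficient of t^|w|. The product of the terms indexed by u and v is indexed
   by uv. *)

Definition Bterm alpha : seq A -> operator :=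
  fun w psi => alpha w *: word_op w psi.

(* The term indexed by w is now the coefficient of t^(|w| - 1). *)
Definition ddt_term (F : seq A -> operator) : seq A -> operator :=
  fun w psi => (wdeg deg w)%:R *: F w psi.

(* The formal pullback along the flow of F_t = sum_(w <> 1) t^(|w| - 1) F w,
   determined by [pullback_term0] and [pullback_termS]. *)
Fixpoint pullback_term_rec (F : seq A -> operator) (fuel : nat) w : operator :=
  fun psi =>
  match fuel, w with
  | fuel'.+1, _ :: _ =>
      (wdeg deg w)%:R^-1 *:
        \sum_(i < size w)
          pullback_term_rec F fuel' (take i w) (F (drop i w) psi)
  | _, _ => psi
  end.

Definition pullback_term (F : seq A -> operator) w : operator :=
  pullback_term_rec F (size w) w.

Lemma pullback_term_rec_fuel F fuel w psi : (size w <= fuel)%N ->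
  pullback_term_rec F fuel w psi = pullback_term F w psi.
Proof.
rewrite /pullback_term; have [m] := ubnP (size w).
elim: m w fuel psi => // m IH [|a w] [|f] psi // wm wf.
rewrite [LHS]/= [RHS]/=; congr (_ *: _); apply: eq_bigr => i _.
have iw : (size (take i (a :: w)) <= size w)%N.
  by rewrite size_take_min geq_min -ltnS ltn_ord.
by rewrite [LHS]IH ?[RHS]IH // ?(leq_trans iw) // (leq_ltn_trans iw).
Qed.

Lemma pullback_term0 F psi : pullback_term F [::] psi = psi.
Proof. by []. Qed.

Lemma pullback_termS F w psi : (0 < wdeg deg w)%N ->
  (wdeg deg w)%:R *: pullback_term F w psi =
  \sum_(i < size w) pullback_term F (take i w) (F (drop i w) psi).
Proof.
case: w => [|a w] w0; first by rewrite /wdeg big_nil in w0.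
rewrite /pullback_term [pullback_term_rec F (size _) _]/= scalerA divff.
  rewrite scale1r; apply: eq_bigr => i _.
  rewrite pullback_term_rec_fuel // size_take_min geq_min -ltnS ltn_ord //.
by rewrite pnatr_eq0 -lt0n.
Qed.

End FormalSeries.

(* Main.v *)
Require Import Defs.
From HB Require Import structures.
From mathcomp Require Import all_boot all_order all_algebra finmap.
From mathcomp Require Import monalg.
From mathcomp Require Import all_classical all_reals all_analysis.
From mathcomp Require Import zify ring.

Set Implicit Arguments.
Unset Strict Implicit.
Unset Printing Implicit Defensive.

Import Order.TTheory GRing.Theory Num.Theory numFieldNormedType.Exports.
Local Open Scope classical_set_scope.
Local Open Scope ring_scope.

(** Everything rests on one identity. Write [Y] for the grading and [*] for
the convolution, and let [beta = Q alpha]. Then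
<<
    beta o Y = beta * (alpha o Y),
>>
that is, [|w| beta(w)] is the sum over the factorizations [w = uv] of
[beta(u) |v| alpha(v)] ([Q_recursion]). The denominators in the definition of
[Q] are made for this: splitting off the last part [j] of a composition of
[n] turns the coefficient of the composition, multiplied by [n], into [j] times
the coefficient of what is left. As letters have positive degree, the identity
determines [beta] from [alpha].

- Pullback. The operators [F_nu] turn concatenation of words into composition,
  and they are linear on smooth functions, so that the identity says exactly
  that [d/dt B_t(beta)] is [B_t(beta)] applied after [d/dt B_t(alpha)]. This is
  the equation that defines the formal pullback along the flow of
  [F_t = d/dt B_t(alpha)], and both sides are the identity at [t = 0]
  ([pullback_term_Bterm], and [pullback_Bseries] where the words of each degree
  are finitely many and can be summed). The analytic input is that a Lie
  derivative may be computed in any chart, hence maps smooth functions to smooth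
  functions, on which it is linear.

- [beta] is a character. Deconcatenation is multiplicative for the shuffle
  product ([shufflesum_splitsum]), and [alpha o Y] vanishes on the shuffle of
  two non-empty words. So the identity, evaluated on the shuffle of [u] and [v],
  reduces by induction to
  [|u| beta(u) beta(v) + beta(u) |v| beta(v)] ([Q_character]).

- Dynkin operator. As [beta] is a character, [beta o D] is the convolution of
  [beta o S] and [beta o Y], and [beta o S] is inverse to [beta] by the antipode
  identity ([antipode_shufflesum]). By associativity
  [beta o D = (beta o S) * beta * (alpha o Y) = alpha o Y] ([Q_dynkin_op]). *)

(** * Sums over deconcatenations and over shuffles *)

Section SplitSum.
Variable T : Type.
Implicit Types (V : zmodType) (u v w : seq T).

Definition splitsum V (f : seq T -> seq T -> V) w : V :=
  \sum_(i < (size w).+1) f (take i w) (drop i w).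

Lemma splitsum_nil V f : @splitsum V f [::] = f [::] [::].
Proof. by rewrite /splitsum big_ord_recl big_ord0 addr0. Qed.

(** The recursion that replaces indices in the inductions below: either the
left factor is empty, or it starts with the first letter. *)
Lemma splitsum_cons V f a w :
  @splitsum V f (a :: w) =
  f [::] (a :: w) + splitsum (fun u v => f (a :: u) v) w.
Proof. by rewrite /splitsum big_ord_recl. Qed.

Lemma splitsum_recr V f w :
  @splitsum V f w =
  \sum_(i < size w) f (take i w) (drop i w) + f w [::].
Proof. by rewrite /splitsum big_ord_recr /= take_size drop_size. Qed.

Lemma eq_splitsum V (f g : seq T -> seq T -> V) w :
  (forall u v, u ++ v = w -> f u v = g u v) -> splitsum f w = splitsum g w.
Proof. by move=> fg; apply: eq_bigr => i _; apply: fg; apply: cat_take_drop. Qed.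

Lemma splitsumD V (f g : seq T -> seq T -> V) w :
  splitsum (fun u v => f u v + g u v) w = splitsum f w + splitsum g w.
Proof. exact: big_split. Qed.

Lemma raddf_splitsum V V' (h : {additive V -> V'}) (f : seq T -> seq T -> V) w :
  h (splitsum f w) = splitsum (fun u v => h (f u v)) w.
Proof. exact: raddf_sum. Qed.

Lemma splitsum_sum V (I : Type) (r : seq I) (P : pred I)
    (f : I -> seq T -> seq T -> V) w :
  \sum_(i <- r | P i) splitsum (f i) w =
  splitsum (fun u v => \sum_(i <- r | P i) f i u v) w.
Proof. exact: exchange_big. Qed.

(** Coassociativity of deconcatenation: both sides sum over the factorizations
of the word into three factors. *)
Lemma splitsumA V (f : seq T -> seq T -> seq T -> V) w :
  splitsum (fun u v => splitsum (f u) v) w =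
  splitsum (fun u v => splitsum (fun u1 u2 => f u1 u2 v) u) w.
Proof.
elim: w f => [|a w IH] f; first by rewrite !splitsum_nil.
rewrite !splitsum_cons IH splitsum_nil -addrA -splitsumD.
by congr (_ + _); apply: eq_splitsum => u v _; rewrite splitsum_cons.
Qed.

End SplitSum.

Section ShuffleSum.
Variables (A : choiceType) (V : zmodType).
Implicit Types (u v w : seq A).

Definition shufflesum (g : seq A -> V) u v : V := \sum_(w <- shuffles u v) g w.

Lemma shufflesum0s g v : shufflesum g [::] v = g v.
Proof. by case: v => [|b v]; rewrite /shufflesum /= big_seq1. Qed.

Lemma shufflesums0 g u : shufflesum g u [::] = g u.
Proof. by case: u => [|b u]; rewrite /shufflesum /= big_seq1. Qed.

Lemma shufflesum_cons g a u b v :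
  shufflesum g (a :: u) (b :: v) =
  shufflesum (fun w => g (a :: w)) u (b :: v) +
  shufflesum (fun w => g (b :: w)) (a :: u) v.
Proof. by rewrite /shufflesum /= big_cat !big_map. Qed.

Lemma shufflesumD g h u v :
  shufflesum (fun w => g w + h w) u v = shufflesum g u v + shufflesum h u v.
Proof. exact: big_split. Qed.

Lemma eq_shufflesum g h u v :
  g =1 h -> shufflesum g u v = shufflesum h u v.
Proof. by move=> gh; apply: eq_bigr => w _. Qed.

(** Deconcatenation is multiplicative for the shuffle product. By induction: a
factorization of a shuffle of [au] and [bv] has an empty left factor, or its
left factor starts with [a] or with [b]. *)
Lemma shufflesum_splitsum (f : seq A -> seq A -> V) u v :
  shufflesum (splitsum f) u v =
  splitsum (fun u1 u2 => splitsum (fun v1 v2 =>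
    shufflesum (fun w1 => shufflesum (f w1) u2 v2) u1 v1) v) u.
Proof.
have [m] := ubnP (size u + size v).
elim: m f u v => // m IH f [|a u] [|b v] uvm.
- by rewrite shufflesum0s !splitsum_nil !shufflesum0s.
- rewrite shufflesum0s splitsum_nil; apply: eq_splitsum => v1 v2 _.
  by rewrite !shufflesum0s.
- rewrite shufflesums0; apply: eq_splitsum => v1 v2 _.
  by rewrite splitsum_nil !shufflesums0.
rewrite shufflesum_cons.
under eq_shufflesum do rewrite splitsum_cons.
under [X in _ + X]eq_shufflesum do rewrite splitsum_cons.
rewrite !shufflesumD addrACA -shufflesum_cons !IH; last 2 first.
- by rewrite -ltnS (leq_trans _ uvm) //= addnS.
- by rewrite -ltnS (leq_trans _ uvm) //=.
rewrite [RHS]splitsum_cons [X in _ = X + _]splitsum_cons !shufflesum0s -addrA.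
congr (_ + _); rewrite [X in _ + X = _]splitsum_cons addrCA.
congr (_ + _).
  by apply: eq_splitsum => v1 v2 _; rewrite !shufflesum0s.
rewrite -splitsumD; apply: eq_splitsum => u1 u2 _.
rewrite !splitsum_cons !shufflesums0 -addrA -splitsumD; congr (_ + _).
by apply: eq_splitsum => v1 v2 _; rewrite shufflesum_cons.
Qed.

(** The antipode identity is the case [r = [::]]; the accumulator [r] holds the
letters that have already been reversed, and makes the induction go through. A
shuffle of [c :: r'] and [a :: w] starts with [c] or with [a], and those that
start with [a] cancel against the next term of the alternating sum, where [a]
has moved to the reversed word: the sum telescopes. *)
Lemma antipode_shufflesum (g : seq A -> V) r w :
  splitsum (fun u v => shufflesum g (rev u ++ r) v *~ (-1) ^+ size u) w =
  if r is c :: r' then shufflesum (fun x => g (c :: x)) r' w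
  else if w is [::] then g [::] else 0.
Proof.
elim: w r => [|a w IH] r.
  by rewrite splitsum_nil /= mulr1z; case: r => [|c r]; rewrite !shufflesums0.
rewrite splitsum_cons /= mulr1z.
under eq_splitsum => u v _ do rewrite rev_cons cat_rcons exprS mulN1r mulrNz.
rewrite -(raddf_splitsum (-%R : {additive V -> V})) IH.
case: r => [|c r]; first by rewrite !shufflesum0s subrr.
by rewrite shufflesum_cons addrK.
Qed.

End ShuffleSum.

(** * Linear extension of functions on words *)

Section Linext.
Variables (R : realType) (A : choiceType).
Implicit Types (W : lmodType R) (u v w : seq A).

(** Linearity is read off from this, by evaluating several elements of the free
module on a common support. *)
Lemma linextEw W (f : seq A -> W) (d : {fset seq A}) (p : {malg R[seq A]}) :
  (msupp p `<=` d)%fset -> linext f p = \sum_(w <- d) p@_w *: f w.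
Proof.
move=> pd; rewrite /linext (big_fset_incl _ pd) //= => w _ wp.
by rewrite mcoeff_outdom // scale0r.
Qed.

Lemma linext_is_linear W (f : seq A -> W) : linear (linext f).
Proof.
move=> c p q; set d := (msupp p `|` msupp q `|` msupp (c *: p + q))%fset.
rewrite !(@linextEw _ f d) /d.
- rewrite scaler_sumr -big_split /=; apply: eq_bigr => w _.
  by rewrite mcoeffD mcoeffZ scalerDl scalerA.
- by rewrite fsubsetU // fsubsetUr.
- by rewrite fsubsetU // fsubsetUl.
- by rewrite fsubsetUr.
Qed.

HB.instance Definition _ W (f : seq A -> W) :=
  GRing.isLinear.Build R {malg R[seq A]} W *:%R (linext f)
    (linext_is_linear f).

Lemma linext_word W (f : seq A -> W) w : linext f (word R w) = f w.
Proof.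
rewrite (@linextEw _ _ [fset w]%fset) ?msuppU_le // big_seq_fset1.
by rewrite mcoeffUU scale1r.
Qed.

Lemma linext_shuffle_word W (f : seq A -> W) u v :
  linext f (shuffle_word R u v) = shufflesum f u v.
Proof.
rewrite /shuffle_word linear_sum /shufflesum /=.
by apply: eq_bigr => w _; rewrite linext_word.
Qed.

Lemma shuffle_words (c d : R) u v :
  shuffle (c *: word R u) (d *: word R v) = (c * d) *: shuffle_word R u v.
Proof.
by rewrite /shuffle linearZ /= linext_word linearZ /= linext_word scalerA.
Qed.

End Linext.

Section SumScalars.
Variables (R : realType) (A : choiceType).
Implicit Types (u v w : seq A).

Lemma mulr_splitsumr (c : R) (f : seq A -> seq A -> R) w :
  c * splitsum f w = splitsum (fun u v => c * f u v) w.
Proof. exact: mulr_sumr. Qed.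

Lemma mulr_splitsuml (c : R) (f : seq A -> seq A -> R) w :
  splitsum f w * c = splitsum (fun u v => f u v * c) w.
Proof. exact: mulr_suml. Qed.

Lemma mulr_shufflesumr (c : R) (f : seq A -> R) u v :
  c * shufflesum f u v = shufflesum (fun w => c * f w) u v.
Proof. exact: mulr_sumr. Qed.

Lemma mulr_shufflesuml (c : R) (f : seq A -> R) u v :
  shufflesum f u v * c = shufflesum (fun w => f w * c) u v.
Proof. exact: mulr_suml. Qed.

End SumScalars.

(** * Degree, convolution and compositions *)

Section WordDegree.
Variables (A : choiceType) (deg : A -> nat).
Implicit Types (u v w : seq A).

Lemma wdeg_cat u v : wdeg deg (u ++ v) = (wdeg deg u + wdeg deg v)%N.
Proof. exact: big_cat. Qed.

Lemma wdeg_nil : wdeg deg [::] = 0%N.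
Proof. exact: big_nil. Qed.

Lemma wdeg_rev w : wdeg deg (rev w) = wdeg deg w.
Proof. by apply: perm_big; rewrite perm_rev. Qed.

Lemma wdeg_shuffles u v w :
  w \in shuffles u v -> wdeg deg w = (wdeg deg u + wdeg deg v)%N.
Proof.
have wcons a x : wdeg deg (a :: x) = (deg a + wdeg deg x)%N by exact: big_cons.
have [m] := ubnP (size u + size v); elim: m u v w => // m IH [|a u] [|b v] w.
- by rewrite inE => _ /eqP ->; rewrite wdeg_nil.
- by rewrite inE => _ /eqP ->; rewrite wdeg_nil.
- by rewrite inE => _ /eqP ->; rewrite wdeg_nil addn0.
rewrite ltnS => uvm; rewrite [shuffles _ _]/= mem_cat.
case/orP => /mapP[x xP ->]; rewrite wcons.
  by rewrite (IH _ _ _ _ xP) // !wcons addnA.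
by rewrite (IH (a :: u) v x) ?wcons //; [lia | rewrite /= in uvm *; lia].
Qed.

Hypothesis deg_gt0 : forall a, (0 < deg a)%N.

Lemma wdeg_eq0 w : (wdeg deg w == 0)%N = (w == [::]).
Proof.
case: w => [|a w]; first by rewrite wdeg_nil eqxx.
by rewrite /wdeg big_cons addn_eq0 eqn0Ngt deg_gt0.
Qed.

End WordDegree.

Section Convolution.
Variables (R : realType) (A : choiceType) (deg : A -> nat).
Implicit Types (alpha beta gamma : seq A -> R) (u v w : seq A).

Lemma convolutionE alpha beta w :
  convolution alpha beta w = splitsum (fun u v => alpha u * beta v) w.
Proof. by []. Qed.

Lemma convolutionA alpha beta gamma :
  convolution alpha (convolution beta gamma) =
  convolution (convolution alpha beta) gamma.
Proof.
apply/funext => w; transitivity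
  (splitsum (fun u v =>
    splitsum (fun v1 v2 => alpha u * beta v1 * gamma v2) v) w).
  rewrite convolutionE; apply: eq_splitsum => u v _.
  rewrite convolutionE mulr_splitsumr.
  by apply: eq_splitsum => x y _; rewrite mulrA.
rewrite splitsumA convolutionE; apply: eq_splitsum => u v _.
by rewrite convolutionE mulr_splitsuml.
Qed.

Lemma convolution1l alpha : convolution (@counit R A) alpha = alpha.
Proof.
apply/funext => -[|a w]; rewrite convolutionE ?splitsum_nil ?splitsum_cons.
  by rewrite mul1r.
rewrite mul1r /splitsum big1 ?addr0 // => i _.
by rewrite /counit mul0r.
Qed.

Lemma convolution1r alpha : convolution alpha (@counit R A) = alpha.
Proof.
apply/funext => w; rewrite convolutionE splitsum_recr mulr1 big1 ?add0r // => i _.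
rewrite /counit; case: eqP => [|_]; last by rewrite mulr0.
by move=> /(congr1 size)/eqP; rewrite size_drop subn_eq0 leqNgt ltn_ord.
Qed.

Lemma splitsum_counitl (f : seq A -> R) w :
  splitsum (fun u v => counit R u * f v) w = f w.
Proof. by rewrite -convolutionE convolution1l. Qed.

Lemma splitsum_counitr (f : seq A -> R) w :
  splitsum (fun u v => f u * counit R v) w = f w.
Proof. by rewrite -convolutionE convolution1r. Qed.

End Convolution.

Section Compositions.

(** The compositions of [n], enumerated as in the definition of [Qdeg], which
bounds both the number of parts and their size by [n]. *)
Definition compositions n : seq (seq nat) :=
  [seq map val (tval js) | l <- iota 0 n.+1,
    js <- [seq js : l.-tuple 'I_n.+1 <- enum {: l.-tuple 'I_n.+1} |
            all (fun j : 'I_n.+1 => 0 < j)%N js && (sumn (map val js) == n)]].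

Lemma mem_compositions n js :
  (js \in compositions n) = all (fun j => 0 < j)%N js && (sumn js == n).
Proof.
apply/allpairsPdep/andP => [[l [ks [_ kP ->]]]|[js0 /eqP js_sum]].
  by move: kP; rewrite mem_filter => /andP[/andP[k0 ks_sum] _]; rewrite all_map.
have js_le j : j \in js -> (j <= n)%N.
  rewrite -js_sum; elim: (js) => //= a s IH; rewrite inE => /orP[/eqP ->|/IH].
    exact: leq_addr.
  by move=> /leq_trans -> //; apply: leq_addl.
have jsE : js = map val [seq (inord j : 'I_n.+1) | j <- js].
  rewrite -map_comp -[LHS]map_id; apply/eq_in_map => j /js_le jn /=.
  by rewrite inordK.
exists (size js), (tcast (size_map _ _)
  (in_tuple [seq (inord j : 'I_n.+1) | j <- js])).
rewrite val_tcast; split => //.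
  rewrite mem_iota add0n ltnS -js_sum /=.
  elim: (js) js0 => //= a s IH /andP[a0 /IH]; lia.
rewrite mem_filter mem_enum andbT val_tcast -jsE js_sum eqxx andbT.
by move: js0; rewrite [in X in X -> _]jsE all_map.
Qed.

Lemma compositions_uniq n : uniq (compositions n).
Proof.
apply: allpairs_uniq_dep; first exact: iota_uniq.
  by move=> l _; apply/filter_uniq/enum_uniq.
move=> [l ks] [l' ks'] _ _ /= /(inj_map val_inj) E.
have ll' : l = l' by rewrite -(size_tuple ks) E size_tuple.
by case: l' / ll' in ks' E *; congr existT; apply: val_inj.
Qed.

(** Removing the last part [j] of a composition of [n > 0] leaves a composition
of [n - j]. *)
Lemma perm_compositions_rcons n : (0 < n)%N ->
  perm_eq (compositions n)
    [seq rcons js j | j <- iota 1 n, js <- compositions (n - j)].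
Proof.
move=> n0; apply: uniq_perm; first exact: compositions_uniq.
  apply: allpairs_uniq_dep; first exact: iota_uniq.
    by move=> j _; apply: compositions_uniq.
  by move=> [j js] [k ks] _ _ /= /rcons_inj[-> ->].
move=> js; rewrite mem_compositions; apply/andP/allpairsPdep => /=.
  case/lastP: js => [|js j] [].
    by move=> _ /eqP js0; rewrite -js0 in n0.
  rewrite all_rcons sumn_rcons => /andP[j0 js0] /eqP js_sum.
  exists j, js; split => //; first by rewrite mem_iota j0 -js_sum /=; lia.
  by rewrite mem_compositions js0 -js_sum addnK eqxx.
case=> j [ks []]; rewrite mem_iota add1n ltnS => /andP[j0 jn].
rewrite mem_compositions => /andP[ks0 /eqP ks_sum] ->.
by rewrite all_rcons j0 ks0 sumn_rcons ks_sum subnK.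
Qed.

End Compositions.

(** * The convolution equation satisfied by Q *)

Section QRecursion.
Variables (R : realType) (A : choiceType) (deg : A -> nat).
Hypothesis deg_gt0 : forall a, (0 < deg a)%N.
Implicit Types (alpha : seq A -> R) (u v w : seq A) (js : seq nat).

Definition convolution_parts alpha js : seq A -> R :=
  foldr (fun j => convolution (restrict_deg deg alpha j)) (@counit R A) js.

Lemma convolution_parts_rcons alpha js j :
  convolution_parts alpha (rcons js j) =
  convolution (convolution_parts alpha js) (restrict_deg deg alpha j).
Proof.
rewrite /convolution_parts; elim: js => [|i js IH] /=.
  by rewrite convolution1l convolution1r.
by rewrite IH convolutionA.
Qed.

Lemma convolution_parts_eq0 alpha js w :
  wdeg deg w != sumn js -> convolution_parts alpha js w = 0.
Proof.
elim: js w => [|j js IH] w /=.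
  by rewrite wdeg_eq0 // /counit => /negPf ->.
rewrite -/(convolution_parts alpha js) convolutionE => wjs.
rewrite /splitsum big1 // => i _.
rewrite /restrict_deg; case: eqP => [uj|_]; last by rewrite mul0r.
rewrite IH ?mulr0 //.
by apply: contraNneq wjs => <-; rewrite -uj -wdeg_cat cat_take_drop.
Qed.

Lemma Qdeg_compositions alpha m w :
  Qdeg deg alpha m w =
  \sum_(js <- compositions m) Qcoef R js * convolution_parts alpha js w.
Proof.
rewrite /Qdeg /compositions big_allpairs_dep -[iota 0 m.+1]/(index_iota 0 m.+1).
rewrite big_mkord; apply: eq_bigr => l _; rewrite big_filter big_enum_cond /=.
by apply: eq_bigr => js _; rewrite /convolution_parts foldr_map.
Qed.

(** Only the compositions of the degree of [w] contribute to the value at [w];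
the counit is the contribution of the empty composition. *)
Lemma Q_compositions alpha w :
  Q deg alpha w =
  \sum_(js <- compositions (wdeg deg w))
    Qcoef R js * convolution_parts alpha js w.
Proof.
rewrite -Qdeg_compositions /Q /counit -(wdeg_eq0 deg_gt0).
case: (wdeg deg w =P 0%N) => [w0|/eqP w0].
  rewrite w0 big_geq // addr0 Qdeg_compositions.
  have c0 : perm_eq (compositions 0) [:: [::]].
    apply: uniq_perm; rewrite ?compositions_uniq // => js.
    rewrite mem_compositions inE; by case: js => [|[|j] js] //=; rewrite andbF.
  rewrite (perm_big _ c0) /= big_seq1 /Qcoef !big_nil divr1 mul1r /= /counit.
  by move/eqP: w0; rewrite wdeg_eq0 // => ->.
rewrite add0r big_nat_recr ?lt0n //= big_nat big1 ?add0r // => m /andP[_ mw].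
rewrite Qdeg_compositions big_seq big1 // => js.
rewrite mem_compositions => /andP[_ /eqP jsm].
by rewrite convolution_parts_eq0 ?mulr0 // jsm gtn_eqF.
Qed.

(** The last factor of the denominator is the sum of all the parts. *)
Lemma Qcoef_rcons js j : (0 < j)%N ->
  (sumn js + j)%:R * Qcoef R (rcons js j) = j%:R * Qcoef R js.
Proof.
move=> j0; rewrite /Qcoef scanl_rcons !big_rcons /=.
have -> : foldl addn 0%N (rcons js j) = (sumn js + j)%N.
  by rewrite -sumn_rcons /sumn; apply: foldl_foldr; [exact: addnA|exact: addnC].
have sj0 : (sumn js + j)%:R != 0 :> R by rewrite pnatr_eq0; lia.
rewrite invfM; set P := (\prod_(i <- js) _).
set S := (\prod_(i <- scanl _ _ _) _)^-1.
set N := (sumn js + j)%:R in sj0 *; clearbody N; by field.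
Qed.

(** The identity [beta o Y = beta * (alpha o Y)] for [beta = Q alpha]. Sort the
compositions by their last part [j]; in the factorization [w = uv] only
[j = |v|] contributes, and what remains of the sum is [Q alpha] at [u]. *)
Lemma Q_recursion alpha w :
  (wdeg deg w)%:R * Q deg alpha w =
  splitsum (fun u v => Q deg alpha u * ((wdeg deg v)%:R * alpha v)) w.
Proof.
case: (posnP (wdeg deg w)) => [w0|w0].
  move/eqP: w0; rewrite wdeg_eq0 // => /eqP ->.
  by rewrite splitsum_nil wdeg_nil !mul0r mulr0.
rewrite Q_compositions (perm_big _ (perm_compositions_rcons w0)) /=.
rewrite big_allpairs_dep mulr_sumr.
transitivity (\sum_(j <- iota 1 (wdeg deg w)) splitsum (fun u v =>
    \sum_(js <- compositions (wdeg deg w - j))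
      Qcoef R js * convolution_parts alpha js u *
        (j%:R * restrict_deg deg alpha j v)) w).
  rewrite [LHS]big_seq [RHS]big_seq; apply: eq_bigr => j.
  rewrite mem_iota add1n ltnS => /andP[j0 jw].
  rewrite -splitsum_sum mulr_sumr [LHS]big_seq [RHS]big_seq; apply: eq_bigr => js.
  rewrite mem_compositions => /andP[_ /eqP js_sum].
  have -> : wdeg deg w = (sumn js + j)%N by rewrite js_sum subnK.
  rewrite mulrA Qcoef_rcons // convolution_parts_rcons convolutionE.
  by rewrite mulr_sumr; apply: eq_bigr => i _; ring.
rewrite splitsum_sum; apply: eq_splitsum => u v uvw.
have uvE : wdeg deg w = (wdeg deg u + wdeg deg v)%N by rewrite -uvw wdeg_cat.
under eq_bigr => j _ do rewrite -mulr_suml.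
have [v0|v0] := posnP (wdeg deg v).
  rewrite v0 mul0r mulr0 big_seq big1 // => j.
  rewrite mem_iota => /andP[j0 _]; rewrite /restrict_deg v0.
  by rewrite eq_sym (gtn_eqF j0) !mulr0.
rewrite (bigD1_seq (wdeg deg v)) ?iota_uniq //=; last first.
  by rewrite mem_iota add1n v0 ltnS uvE leq_addl.
rewrite [X in _ + X]big1 ?addr0 => [|j jv]; last first.
  by rewrite /restrict_deg eq_sym (negPf jv) !mulr0.
by rewrite /restrict_deg eqxx uvE addnK -Q_compositions.
Qed.

End QRecursion.

(** * Characters and the Dynkin operator *)

Section Dynkin.
Variables (R : realType) (A : choiceType) (deg : A -> nat).
Hypothesis deg_gt0 : forall a, (0 < deg a)%N.
Implicit Types (alpha beta : seq A -> R) (u v w : seq A).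

Lemma pairing_shuffle_word alpha u v :
  pairing alpha (shuffle_word R u v) = shufflesum alpha u v.
Proof. exact: (linext_shuffle_word (alpha : seq A -> R^o)). Qed.

Lemma Q_nil alpha : Q deg alpha [::] = 1.
Proof. by rewrite /Q wdeg_nil big_geq // addr0. Qed.

(** By induction on the total length: the value of [Q alpha] on the shuffle of
[u] and [v], multiplied by the degree, is computed by [Q_recursion], and [alpha]
kills the shuffles of non-empty words, so that one of the two right factors is
empty. *)
Lemma Q_character alpha :
  infinitesimal_character alpha -> character (Q deg alpha).
Proof.
move=> [alpha0 alphaI]; split=> [|u v]; first exact: Q_nil.
rewrite pairing_shuffle_word.
have [m] := ubnP (size u + size v); elim: m u v => // m IH u v.
rewrite ltnS => uvm.
have [uv0|uv0] := eqVneq (wdeg deg u + wdeg deg v)%N 0%N.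
  have [/eqP + /eqP] : wdeg deg u = 0%N /\ wdeg deg v = 0%N by lia.
  rewrite !wdeg_eq0 // => /eqP -> /eqP ->.
  by rewrite shufflesum0s Q_nil mulr1.
apply: (@mulfI _ (wdeg deg u + wdeg deg v)%:R); first by rewrite pnatr_eq0.
pose aY w := (wdeg deg w)%:R * alpha w.
have aY0 : aY [::] = 0 by rewrite /aY alpha0 mulr0.
have aY_shuffle x y :
    shufflesum aY x y = aY x * counit R y + counit R x * aY y.
  rewrite /counit; case: x y => [|a x] [|b y].
  - by rewrite shufflesum0s aY0 mul0r mulr0 addr0.
  - by rewrite shufflesum0s aY0 mul0r mul1r add0r.
  - by rewrite shufflesums0 aY0 mulr1 mul0r addr0.
  rewrite mulr0 mul0r addr0 /shufflesum big_seq.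
  under eq_bigr => w wxy do rewrite /aY (wdeg_shuffles deg wxy).
  rewrite -mulr_sumr -big_seq -/(shufflesum alpha _ _) -pairing_shuffle_word.
  by rewrite alphaI // mulr0.
(* As [aY] vanishes at the empty word, [f] only matters on proper prefixes of
   [w], and there the induction hypothesis will apply. *)
have aY_eq (f : seq A -> R) c w : (forall x y, x ++ y = w -> y != [::] ->
    f x = Q deg alpha x * c) ->
    splitsum (fun x y => f x * aY y) w = (wdeg deg w)%:R * Q deg alpha w * c.
  move=> fP; rewrite Q_recursion // mulr_splitsuml.
  apply: eq_splitsum => x y xyw; case: (eqVneq y [::]) => [->|y0].
    by rewrite -/(aY [::]) aY0 !mulr0 mul0r.
  by rewrite (fP x y) // mulrAC.
have -> : (wdeg deg u + wdeg deg v)%:R * shufflesum (Q deg alpha) u v =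
    shufflesum (splitsum (fun x y => Q deg alpha x * aY y)) u v.
  rewrite mulr_shufflesumr /shufflesum [LHS]big_seq [RHS]big_seq.
  by apply: eq_bigr => w wuv; rewrite -(wdeg_shuffles deg wuv) Q_recursion.
rewrite shufflesum_splitsum.
transitivity (splitsum (fun u1 u2 =>
    shufflesum (Q deg alpha) u1 v * aY u2 +
    splitsum (fun v1 v2 => shufflesum (Q deg alpha) u1 v1 * aY v2) v *
      counit R u2) u).
  apply: eq_splitsum => u1 u2 _.
  rewrite -[X in X * aY u2](splitsum_counitr (shufflesum (Q deg alpha) u1)).
  rewrite !mulr_splitsuml -splitsumD; apply: eq_splitsum => v1 v2 _.
  under eq_shufflesum do rewrite -mulr_shufflesumr aY_shuffle.
  by rewrite -mulr_shufflesuml; ring.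
rewrite splitsumD splitsum_counitr.
rewrite (aY_eq _ (Q deg alpha v)) => [|x y xyu y0]; last first.
  apply: IH; apply: leq_trans uvm; rewrite -xyu size_cat.
  by rewrite ltn_add2r -addn1 leq_add2l lt0n size_eq0.
rewrite (aY_eq _ (Q deg alpha u)) => [|x y xyv y0]; last first.
  rewrite mulrC; apply: IH; apply: leq_trans uvm; rewrite -xyv size_cat.
  by rewrite ltn_add2l -addn1 leq_add2l lt0n size_eq0.
by rewrite natrD; ring.
Qed.

Lemma dynkin_op_word w :
  dynkin_op deg (word R w) = splitsum (fun u v =>
    ((-1) ^+ size u * (wdeg deg v)%:R) *: shuffle_word R (rev u) v) w.
Proof.
rewrite /dynkin_op /end_conv linext_word.
rewrite -[LHS]/(splitsum (fun u v =>
  shuffle (antipode (word R u)) (grading deg (word R v))) w).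
apply: eq_splitsum => u v _.
by rewrite /antipode /grading !linext_word shuffle_words.
Qed.

(** [beta o D = (beta o S) * (beta o Y) = (beta o S) * beta * (alpha o Y)], and
[(beta o S) * beta] is the counit. *)
Lemma Q_dynkin_op alpha w : infinitesimal_character alpha ->
  pairing (Q deg alpha) (dynkin_op deg (word R w)) = (wdeg deg w)%:R * alpha w.
Proof.
move=> alphaI; have [_ QM] := Q_character alphaI.
rewrite dynkin_op_word /pairing raddf_splitsum.
transitivity (splitsum (fun u v => splitsum (fun v1 v2 =>
    (-1) ^+ size u * Q deg alpha (rev u) * Q deg alpha v1 *
    ((wdeg deg v2)%:R * alpha v2)) v) w).
  apply: eq_splitsum => u v _.
  rewrite /= linearZ /= -/(pairing _ _) QM.
  transitivity ((-1) ^+ size u * Q deg alpha (rev u) *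
      ((wdeg deg v)%:R * Q deg alpha v)).
    by rewrite /GRing.scale /=; ring.
  rewrite Q_recursion // mulr_splitsumr.
  by apply: eq_splitsum => x y _; rewrite mulrA.
rewrite splitsumA; transitivity (splitsum (fun u v =>
    counit R u * ((wdeg deg v)%:R * alpha v)) w); last exact: splitsum_counitl.
apply: eq_splitsum => u v _; rewrite -mulr_splitsuml; congr (_ * _).
have := antipode_shufflesum (Q deg alpha) [::] u; rewrite /= Q_nil.
rewrite [RHS](_ : _ = counit R u); last by case: u.
move=> <-; apply: eq_splitsum => x y _.
rewrite cats0 -pairing_shuffle_word QM.
by rewrite -mulrA -mulrzl rmorphXn rmorphN1.
Qed.

(** The Dynkin operator preserves the degree. *)
Lemma grading_inv_dynkin_op alpha w :
  pairing alpha (grading_inv deg (dynkin_op deg (word R w))) =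
  (wdeg deg w)%:R^-1 * pairing alpha (dynkin_op deg (word R w)).
Proof.
suff -> : grading_inv deg (dynkin_op deg (word R w)) =
    (wdeg deg w)%:R^-1 *: dynkin_op deg (word R w).
  by rewrite /pairing linearZ.
rewrite dynkin_op_word /grading_inv !raddf_splitsum.
apply: eq_splitsum => u v uvw; rewrite /= linearZ /= linext_shuffle_word.
rewrite /shufflesum big_seq.
under eq_bigr => x xP do rewrite (wdeg_shuffles deg xP).
rewrite -big_seq -scaler_sumr !scalerA wdeg_rev -wdeg_cat uvw.
by congr (_ *: _); rewrite mulrC.
Qed.

End Dynkin.

(** * Differential calculus of smooth maps *)

Section Differentiable.
Variables (R : realType) (W V : normedModType R).
Implicit Types (f g : W -> V) (x v : W).

(** The difference of the two functions vanishes near [x], so that its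
differential is 0 there. *)
Lemma near_eq_differentiable f g x :
  (\forall y \near x, f y = g y) -> differentiable f x -> differentiable g x.
Proof.
move=> fg df; pose h := g - f.
have h0 : \forall y \near x, h y = 0.
  by apply: filterS fg => y; move=> fgy; rewrite /h !fctE fgy subrr.
have hx : h \o shift x = cst (h x) + (\0 : W -> V) +o_ (0 : W) id.
  apply/eqaddoP => e e0; rewrite (nbhs_singleton h0).
  have : \forall y \near (0 : W), h (y + x) = 0.
    by rewrite (near_shift x 0) /= sub0r; apply: filterS h0 => y; rewrite /= subrK.
  apply: filterS => y hy.
  by rewrite /= !fctE /= hy addr0 subr0 normr0 mulr_ge0 // ltW.
have dh : 'd h x = \0 :> (W -> V).
  by apply: (diff_unique (df := \0)) hx => y; apply: cvg_cst.
have <- : f + h = g by rewrite /h addrC subrK.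
apply: differentiableD => //; apply/diff_locallyP; rewrite dh; split=> //.
by move=> y; apply: cvg_cst.
Qed.

Lemma scale_is_bilinear :
  bilinear_for
    (GRing.Scale.Law.clone _ _ *:%R _) (GRing.Scale.Law.clone _ _ *:%R _)
    (@GRing.scale R V : R^o -> V -> V).
Proof.
split=> [v|c] a x y /=; first by rewrite scalerDl scalerA.
by rewrite scalerDr !scalerA mulrC.
Qed.
HB.instance Definition _ := bilinear_isBilinear.Build R R^o V V _ _
  (@GRing.scale R V : R^o -> V -> V) scale_is_bilinear.

End Differentiable.

Section ScaleDerivative.
Variables (R : realType) (W V : normedModType R).
Implicit Types (k : W -> R) (f : W -> V) (x v : W).

(** The product rule, from the differential of the bilinear map [*:%R]. *)
Lemma is_diff_scale_fun k f x : differentiable k x -> differentiable f x ->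
  is_diff x (fun y => k y *: f y) (fun v => k x *: 'd f x v + 'd k x v *: f x).
Proof.
move=> dk df; pose s (p : R^o * V) : V := p.1 *: p.2.
have sc : continuous s by exact: scale_continuous.
have ds p : is_diff p s (fun q => p.1 *: q.2 + q.1 *: p.2).
  apply: DiffDef.
    exact: (differentiable_bilin (f := @GRing.scale R V : R^o -> V -> V)).
  exact: (diff_bilin (f := @GRing.scale R V : R^o -> V -> V)).
have dkf : is_diff x (fun y => (k y : R^o, f y)) (fun v => ('d k x v, 'd f x v)).
  by apply: is_diff_pair; apply: differentiableP.
exact: (@is_diff_comp _ _ _ _ _ _ s _ x dkf (ds _)).
Qed.

Lemma differentiable_scale_fun k f x : differentiable k x -> differentiable f x ->
  differentiable (fun y => k y *: f y) x.
Proof. by move=> dk df; case: (is_diff_scale_fun dk df). Qed.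

Lemma derive_scale_fun k f x v : differentiable k x -> differentiable f x ->
  'D_v (fun y => k y *: f y) x = k x *: 'D_v f x + 'D_v k x *: f x.
Proof.
move=> dk df; have [dkf E] := is_diff_scale_fun dk df.
by rewrite !deriveE // E.
Qed.

End ScaleDerivative.

Section Ck.
Variables (R : realType) (n : nat) (U : set 'rV[R]_n).
Hypothesis U_open : open U.
Implicit Types (V : normedModType R) (k : nat).

Lemma open_near_eq V (f g : 'rV[R]_n -> V) x :
  (forall y, U y -> f y = g y) -> U x -> \forall y \near x, f y = g y.
Proof.
move=> fg Ux; have : \forall y \near x, U y by exact: open_nbhs_nbhs.
by apply: filterS.
Qed.

(** Differentiability and derivatives only depend on germs, and [U] is open. *)
Lemma Ck_on_eq V (f g : 'rV[R]_n -> V) k :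
  (forall x, U x -> f x = g x) -> Ck_on k U f -> Ck_on k U g.
Proof.
elim: k f g => [|k IH] f g fg.
  move=> fC x Ux; rewrite /prop_for /continuous_at -(fg x Ux).
  exact: cvg_trans (near_eq_cvg (open_near_eq fg Ux)) (fC x Ux).
move=> [df Df]; split=> [x Ux|i].
  by apply: near_eq_differentiable (df x Ux); apply: open_near_eq.
apply: IH (Df i) => x Ux; apply: near_eq_derive.
exact: open_near_eq.
Qed.

Lemma Ck_onW V (f : 'rV[R]_n -> V) k : Ck_on k.+1 U f -> Ck_on k U f.
Proof.
elim: k f => [|k IH] f [df Df].
  by move=> x Ux; apply: differentiable_continuous; apply: df.
by split=> // i; apply: IH; apply: Df.
Qed.

Lemma Ck_on_cst V (c : V) k : Ck_on k U (fun _ => c).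
Proof.
elim: k c => [|k IH] c; first by move=> x _; exact: (@cst_continuous _ _ c x).
split=> // i; apply: Ck_on_eq (IH 0) => x _.
by rewrite derive_cst.
Qed.

Lemma Ck_onD V (f g : 'rV[R]_n -> V) k :
  Ck_on k U f -> Ck_on k U g -> Ck_on k U (fun x => f x + g x).
Proof.
elim: k f g => [|k IH] f g.
  by move=> fC gC x Ux; apply: continuousD; [exact: fC | exact: gC].
move=> [df Df] [dg Dg]; split=> [x Ux|i].
  by apply: differentiableD; [exact: df | exact: dg].
apply: Ck_on_eq (IH _ _ (Df i) (Dg i)) => x Ux.
by rewrite deriveD //; apply: diff_derivable; [exact: df | exact: dg].
Qed.

(** The Leibniz rule involves [c] and [f] themselves next to their derivatives:
this is where [Ck_onW] is needed. *)
Lemma Ck_on_scale V (c : 'rV[R]_n -> R) (f : 'rV[R]_n -> V) k :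
  Ck_on k U c -> Ck_on k U f -> Ck_on k U (fun x => c x *: f x).
Proof.
elim: k c f => [|k IH] c f.
  by move=> cC fC x Ux; exact: continuousZ (cC x Ux) (fC x Ux).
move=> cC fC; have [[dc Dc] [df Df]] := (cC, fC).
split=> [x Ux|i].
  by apply: differentiable_scale_fun; [exact: dc | exact: df].
apply: Ck_on_eq (Ck_onD (IH _ _ (Ck_onW cC) (Df i)) (IH _ _ (Dc i) (Ck_onW fC))).
by move=> x Ux; rewrite derive_scale_fun //; [exact: dc | exact: df].
Qed.

Lemma Ck_on_sum V (I : Type) (r : seq I) (f : I -> 'rV[R]_n -> V) k :
  (forall i, Ck_on k U (f i)) -> Ck_on k U (fun x => \sum_(i <- r) f i x).
Proof.
move=> fC; elim: r => [|i r IH].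
  by apply: Ck_on_eq (Ck_on_cst (0 : V) k) => x _; rewrite big_nil.
by apply: Ck_on_eq (Ck_onD (fC i) IH) => x _; rewrite big_cons.
Qed.

Lemma Ck_on_coord m (F : 'rV[R]_n -> 'rV[R]_m) j k :
  Ck_on k U F -> Ck_on k U (fun x => F x 0 j : R).
Proof.
elim: k F => [|k IH] F.
  move=> FC x Ux.
  apply: (continuous_comp (f := F) (g := fun N : 'rV[R]_m => N 0 j : R)).
    exact: FC.
  exact: coord_continuous.
move=> [dF DF]; have dFj x : U x -> differentiable (fun y => F y 0 j : R) x.
  move=> Ux.
  apply: (differentiable_comp (f := F) (g := fun N : 'rV[R]_m => N 0 j : R)).
    exact: dF.
  exact: differentiable_coord.
split=> [//|i]; apply: Ck_on_eq (IH _ (DF i)) => x Ux.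
rewrite derive_mx ?mxE //; exact/diff_derivable/dF.
Qed.

Lemma derive_coordE V (f : 'rV[R]_n -> V) x v : differentiable f x ->
  'D_v f x = \sum_(i < n) v 0 i *: 'D_(delta_mx 0 i) f x.
Proof.
move=> df; rewrite deriveE // [in LHS](row_sum_delta v) linear_sum.
by apply: eq_bigr => i _; rewrite linearZ /= deriveE.
Qed.

(** In coordinates the derivative along [F] is a sum of products of components
of [F] with partial derivatives of [f]. *)
Lemma smooth_on_derive V (f : 'rV[R]_n -> V) (F : 'rV[R]_n -> 'rV[R]_n) :
  smooth_on U f -> smooth_on U F -> smooth_on U (fun x => 'D_(F x) f x).
Proof.
move=> fC FC k; have [df Df] := fC k.+1.
apply: (@Ck_on_eq _ (fun x => \sum_(i < n) F x 0 i *: 'D_(delta_mx 0 i) f x)).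
  by move=> x Ux; rewrite [RHS]derive_coordE //; exact: df.
apply: Ck_on_sum => // i; apply: Ck_on_scale => //; last exact: Df.
by apply: Ck_on_coord => //; exact: FC.
Qed.

End Ck.

(** * Lie derivatives on a manifold *)

Section LieDerivative.
Variables (R : realType) (n : nat) (M : manifold R n) (V : normedModType R).
Implicit Types (psi phi : M -> V) (F : vector_field M).
Local Notation dom i := (chart_dom (atlas i)).
Local Notation cmap i := (chart_map (atlas i)).
Local Notation cinv i := (chart_inv (atlas i)).

Lemma chart_at_dom (x : M) : dom (chart_at x) x.
Proof. by rewrite /chart_at; case: cid. Qed.

Lemma smooth_differentiable psi (i : chart_index M) (x : M) :
  smooth psi -> dom i x -> differentiable (psi \o cinv i) (cmap i x).
Proof. by move=> sm ix; have [d _] := sm i 1%N; apply: d; exists x. Qed.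

(** The chart chosen by [chart_at] depends on the point in an uncontrolled way;
by the chain rule for the transition map [tau] any chart around [x] gives the
same value. *)
Lemma lie_derivative_chart F psi (j : chart_index M) (x : M) :
  smooth psi -> dom j x ->
  lie_derivative F psi x = 'D_(vf_coord F j x) (psi \o cinv j) (cmap j x).
Proof.
move=> sm jx; rewrite /lie_derivative; set i := chart_at x.
have ix : dom i x := chart_at_dom x.
pose tau := cmap i \o cinv j.
have dtau : differentiable tau (cmap j x).
  by have [d _] := atlas_compat j i 1; apply: d; exists x.
have tauE : tau (cmap j x) = cmap i x by rewrite /tau /= chart_mapK.
have dpsi : differentiable (psi \o cinv i) (tau (cmap j x)).
  by rewrite tauE; apply: smooth_differentiable.
have near_tau : \forall y \near cmap j x,
    ((psi \o cinv i) \o tau) y = (psi \o cinv j) y.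
  have : \forall y \near cmap j x, dom i (cinv j y).
    have inv_cont : {for cmap j x, continuous (cinv j)}.
      by apply: chart_inv_continuous; exists x.
    apply: inv_cont; rewrite chart_mapK //; apply: open_nbhs_nbhs.
    by split=> //; apply: chart_dom_open.
  by apply: filterS => y iy; rewrite /tau /= chart_mapK.
rewrite -(near_eq_derive _ near_tau) [RHS]deriveE; last first.
  exact: (differentiable_comp dtau dpsi).
rewrite diff_comp // tauE /= deriveE; last exact: smooth_differentiable.
by rewrite (vf_compat F jx ix).
Qed.

(** On the domain of a fixed chart the Lie derivative is computed in that chart,
where it is the derivative of a smooth map along a smooth field. *)
Lemma smooth_lie_derivative F psi : smooth psi -> smooth (lie_derivative F psi).
Proof.
move=> sm j; have U_open := chart_im_open (c := atlas j).
move=> k.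
apply: (Ck_on_eq U_open _ (smooth_on_derive U_open (sm j) (vf_smooth F j) k)).
by move=> _ [x jx <-]; rewrite /= !chart_mapK // -lie_derivative_chart.
Qed.

Lemma smooth0 : smooth (0 : M -> V).
Proof. by move=> i k; apply: (Ck_on_cst _ (0 : V)); apply: chart_im_open. Qed.

Lemma smoothD psi phi : smooth psi -> smooth phi -> smooth (psi + phi).
Proof.
by move=> s t i k; apply: (Ck_onD _ (s i k) (t i k)); apply: chart_im_open.
Qed.

Lemma smoothZ (c : R) psi : smooth psi -> smooth (c *: psi).
Proof.
move=> s i k; have U_open := chart_im_open (c := atlas i).
exact: (Ck_on_scale U_open (Ck_on_cst U_open c k) (s i k)).
Qed.

Lemma smooth_sum (I : Type) (r : seq I) (f : I -> M -> V) :
  (forall i, smooth (f i)) -> smooth (\sum_(i <- r) f i).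
Proof.
move=> sm; elim: r => [|i r IH]; first by rewrite big_nil; apply: smooth0.
by rewrite big_cons; apply: smoothD.
Qed.

Lemma lie_derivative0 F : lie_derivative F (0 : M -> V) = 0.
Proof. by apply/funext => x; apply: derive_cst. Qed.

Lemma lie_derivativeD F psi phi : smooth psi -> smooth phi ->
  lie_derivative F (psi + phi) = lie_derivative F psi + lie_derivative F phi.
Proof.
move=> s t; apply/funext => x; rewrite /lie_derivative.
by apply: deriveD; apply: diff_derivable; apply: smooth_differentiable => //;
  apply: chart_at_dom.
Qed.

Lemma lie_derivativeZ F (c : R) psi : smooth psi ->
  lie_derivative F (c *: psi) = c *: lie_derivative F psi.
Proof.
move=> s; apply/funext => x; rewrite /lie_derivative.
by apply: deriveZ; apply: diff_derivable; apply: smooth_differentiable => //;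
  apply: chart_at_dom.
Qed.

Variables (A : choiceType) (nu : A -> vector_field M).
Implicit Types (u v w : seq A).
Local Notation op := (@word_op R n M V A nu).

Lemma smooth_word_op w psi : smooth psi -> smooth (op w psi).
Proof. by move=> s; elim: w => //= a w; apply: smooth_lie_derivative. Qed.

Lemma word_op_cat u v psi : op (u ++ v) psi = op u (op v psi).
Proof. by elim: u => //= a u ->. Qed.

Lemma word_op0 w : op w 0 = 0.
Proof. by elim: w => //= a w ->; apply: lie_derivative0. Qed.

Lemma word_opD w psi phi : smooth psi -> smooth phi ->
  op w (psi + phi) = op w psi + op w phi.
Proof.
move=> s t; elim: w => //= a w ->.
by apply: lie_derivativeD; apply: smooth_word_op.
Qed.

Lemma word_opZ w (c : R) psi : smooth psi -> op w (c *: psi) = c *: op w psi.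
Proof.
move=> s; elim: w => //= a w ->.
by apply: lie_derivativeZ; apply: smooth_word_op.
Qed.

Lemma word_op_sum w (I : Type) (r : seq I) (f : I -> M -> V) :
  (forall i, smooth (f i)) ->
  op w (\sum_(i <- r) f i) = \sum_(i <- r) op w (f i).
Proof.
move=> sm; elim: r => [|i r IH]; first by rewrite !big_nil word_op0.
by rewrite !big_cons word_opD ?IH //; apply: smooth_sum.
Qed.

End LieDerivative.

(** * The formal pullback *)

Section Words.
Variables (A : choiceType) (deg : A -> nat).
Hypothesis deg_gt0 : forall a, (0 < deg a)%N.
Hypothesis deg_fin : forall d, finite_set [set a | deg a = d].
Implicit Types (u v w : seq A).

(** The first letter has degree [d > 0], and the rest of the word has the
smaller degree [m - d]. *)
Lemma finite_words m : finite_set [set w | wdeg deg w = m].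
Proof.
elim/ltn_ind: m => m IH.
apply: (@sub_finite_set _ _ ([set [::]] `|`
  \bigcup_(d in [set d | (0 < d <= m)%N]) ((fun p => p.1 :: p.2) @`
    ([set a | deg a = d] `*` [set w | wdeg deg w = (m - d)%N])))).
  move=> [|a w] wm; [by left | right; exists (deg a)].
    by rewrite /= deg_gt0 -wm /wdeg big_cons leq_addr.
  by exists (a, w); rewrite //= -wm /wdeg big_cons addKn.
rewrite finite_setU; split; first exact: finite_set1.
apply: bigcup_finite.
  by apply: (@sub_finite_set _ _ `I_m.+1) => // d /= /andP[_]; rewrite ltnS.
move=> d /= /andP[d0 dm]; apply: finite_image; apply: finite_setX => //.
by apply: IH; rewrite ltn_subrL d0 (leq_trans d0).
Qed.

Definition words m : seq (seq A) := fset_set [set w | wdeg deg w = m].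

Lemma mem_words m w : (w \in words m) = (wdeg deg w == m).
Proof.
rewrite /words in_fset_set; last exact: finite_words.
by apply/idP/eqP; rewrite inE.
Qed.

(** Both sides sum over the pairs of words whose degrees add up to [m], sorted
on the left by their concatenation and on the right by the degrees. *)
Lemma sum_words_splitsum (V : zmodType) (f : seq A -> seq A -> V) m :
  \sum_(w <- words m) splitsum f w =
  \sum_(k < m.+1) \sum_(u <- words k) \sum_(v <- words (m - k)) f u v.
Proof.
transitivity (\sum_(p <- [seq (take i w, drop i w) |
    w <- words m, i <- iota 0 (size w).+1]) f p.1 p.2).
  rewrite big_allpairs_dep; apply: eq_bigr => w _.
  by rewrite -[iota _ _]/(index_iota 0 (size w).+1) big_mkord.
transitivity (\sum_(p <- [seq p | k <- iota 0 m.+1,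
    p <- [seq (u, v) | u <- words k, v <- words (m - k)]]) f p.1 p.2); last first.
  rewrite big_allpairs_dep -[iota _ _]/(index_iota 0 m.+1) big_mkord.
  by apply: eq_bigr => k _; rewrite big_allpairs.
apply: perm_big; apply: uniq_perm.
- apply: allpairs_uniq_dep => [|w _|]; rewrite ?fset_uniq ?iota_uniq //.
  move=> _ _ /allpairsPdep[w [i [_ wi ->]]] /allpairsPdep[x [j [_ xj ->]]] /=.
  move: wi xj; rewrite !mem_iota !add0n !ltnS => wi xj [tE dE].
  have wx : w = x by rewrite -(cat_take_drop i w) tE dE cat_take_drop.
  have := congr1 size tE; rewrite !size_takel // => ij.
  by rewrite wx ij.
- apply: allpairs_uniq_dep => [|k _|]; first exact: iota_uniq.
    by apply: allpairs_uniq; rewrite ?fset_uniq // => -[? ?] [].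
  move=> _ _ /allpairsPdep[k [p [_ kp ->]]] /allpairsPdep[l [q [_ lq ->]]] /= pq.
  move: kp lq; rewrite pq => /allpairsP[[u v] /= [uk _ ->]].
  move=> /allpairsP[[x y] /= [xl _ [ux _]]]; move: uk xl.
  by rewrite -ux !mem_words => /eqP <- /eqP <-.
move=> [u v]; apply/allpairsPdep/allpairsPdep.
  move=> [w [i [wm _ [-> ->]]]]; move: wm; rewrite mem_words => /eqP wm.
  have twm : (wdeg deg (take i w) + wdeg deg (drop i w))%N = m.
    by rewrite -wdeg_cat cat_take_drop.
  exists (wdeg deg (take i w)), (take i w, drop i w); split=> //.
    by rewrite mem_iota add0n ltnS -twm leq_addr.
  by apply: allpairs_f; rewrite mem_words // -twm addKn.
move=> [k [_ [+ /allpairsP[[x y] /= [+ + ->]]]]] [-> ->].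
rewrite mem_iota add0n ltnS !mem_words => km /eqP xk /eqP yk.
exists (x ++ y), (size x); split.
- by rewrite mem_words wdeg_cat xk yk subnKC.
- rewrite -[_ :: _]/(iota 0 (size (x ++ y)).+1) mem_iota add0n ltnS size_cat.
  exact: leq_addr.
- by rewrite take_size_cat ?drop_size_cat.
Qed.

End Words.

Section Pullback.
Variables (R : realType) (n : nat) (M : manifold R n) (V : normedModType R).
Variables (A : choiceType) (deg : A -> nat) (nu : A -> vector_field M).
Hypothesis deg_gt0 : forall a, (0 < deg a)%N.
Variable alpha : seq A -> R.
Implicit Types (psi : M -> V) (u v w : seq A).
Local Notation beta := (Q deg alpha).

(** The equation of the formal pullback at [w] is [Q_recursion] at [w], applied
to the operator [F_nu(w) = F_nu(u) F_nu(v)]; the right factor [v = 1], absent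
from the pullback, has degree 0. *)
Lemma pullback_term_Bterm w psi : smooth psi ->
  pullback_term deg (ddt_term deg (Bterm nu alpha)) w psi = Bterm nu beta w psi.
Proof.
have [m] := ubnP (size w); elim: m w psi => // m IH w psi wm sm.
have [w0|w0] := posnP (wdeg deg w).
  move/eqP: w0; rewrite wdeg_eq0 // => /eqP ->.
  by rewrite pullback_term0 /Bterm Q_nil scale1r.
apply: (@scalerI _ _ (wdeg deg w)%:R); first by rewrite pnatr_eq0 -lt0n.
rewrite pullback_termS // /Bterm scalerA Q_recursion // splitsum_recr.
rewrite wdeg_nil mul0r mulr0 addr0 scaler_suml; apply: eq_bigr => i _.
have s_op := smooth_word_op nu (drop i w) sm.
rewrite IH; last 2 first.
- by rewrite size_take ltn_ord (leq_trans (ltn_ord i)).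
- by do 2!apply: smoothZ.
rewrite /Bterm /ddt_term scalerA word_opZ // -word_op_cat cat_take_drop.
by rewrite scalerA.
Qed.

Hypothesis deg_fin : forall d, finite_set [set a | deg a = d].

Lemma BseriesE (gamma : seq A -> R) m psi :
  Bseries deg nu gamma m psi =
  \sum_(w <- words deg m) gamma w *: word_op nu w psi.
Proof. by rewrite /Bseries fsbig_finite //; apply: finite_words. Qed.

(** The same computation, summed over all the words of degree [m]. *)
Lemma pullback_Bseries m psi : smooth psi ->
  pullback (ddt (Bseries deg nu alpha)) m psi = Bseries deg nu beta m psi.
Proof.
elim/ltn_ind: m psi => -[|m] IH psi sm.
  rewrite pullback0 /Bseries (_ : [set w | _] = [set [::]]); last first.
    apply/seteqP; split=> w /=; last by move=> ->; apply: wdeg_nil.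
    by move/eqP; rewrite wdeg_eq0 // => /eqP.
  by rewrite fsbig_set1 Q_nil scale1r.
apply: (@scalerI _ _ m.+1%:R); first by rewrite pnatr_eq0.
rewrite pullbackS BseriesE scaler_sumr.
pose f u v := (beta u * ((wdeg deg v)%:R * alpha v)) *: word_op nu (u ++ v) psi.
transitivity (\sum_(w <- words deg m.+1) splitsum f w); last first.
  rewrite [LHS]big_seq [RHS]big_seq; apply: eq_bigr => w.
  rewrite mem_words // => /eqP wm; rewrite scalerA -wm Q_recursion //.
  rewrite /splitsum scaler_suml; apply: eq_bigr => i _.
  by rewrite /f cat_take_drop.
have f0 u v : wdeg deg v = 0%N -> f u v = 0.
  by move=> v0; rewrite /f v0 mul0r mulr0 scale0r.
(* The factorizations with right factor 1 contribute 0. *)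
rewrite sum_words_splitsum // [RHS]big_ord_recr /= subnn.
rewrite [X in _ = _ + X]big1 ?addr0 => [|u _]; last first.
  by rewrite big_seq big1 // => v; rewrite mem_words // => /eqP; apply: f0.
apply: eq_bigr => k _; have km : (k <= m)%N by rewrite -ltnS.
have s_op v : smooth (alpha v *: word_op nu v psi).
  by apply: smoothZ; apply: smooth_word_op.
rewrite IH // ?ltnS //; last first.
  by apply: smoothZ; rewrite BseriesE; apply: smooth_sum.
rewrite BseriesE /ddt -subSn // BseriesE; apply: eq_bigr => u _.
rewrite word_opZ; last exact: smooth_sum.
rewrite (word_op_sum nu u _ s_op) !scaler_sumr.
rewrite [LHS]big_seq [RHS]big_seq; apply: eq_bigr => v.
rewrite mem_words // => /eqP vm; rewrite word_opZ; last exact: smooth_word_op.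
by rewrite /f word_op_cat !scalerA vm mulrA.
Qed.

End Pullback.

Theorem proposition4p9 (R : realType) (n : nat) (M : manifold R n)
    (A : choiceType) (deg : A -> nat) (deg_gt0 : forall a, (0 < deg a)%N)
    (nu : A -> vector_field M) (alpha beta : seq A -> R)
    (alpha_g : infinitesimal_character alpha) (beta_Q : beta = Q deg alpha) :
  [/\ character beta,
      (forall w, alpha w =
         pairing beta (grading_inv deg (dynkin_op deg (word R w)))) &
      forall (V : normedModType R) (psi : M -> V), smooth psi ->
        (forall w,
           pullback_term deg (ddt_term deg (Bterm nu alpha)) w psi =
           Bterm nu beta w psi) /\
        ((forall d, finite_set [set a | deg a = d]) ->
         forall m,
           pullback (ddt (Bseries deg nu alpha)) m psi =
           Bseries deg nu beta m psi)].
Proof.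

rewrite beta_Q; split=> [|w|V psi psi_smooth].
- exact: Q_character.
- rewrite grading_inv_dynkin_op Q_dynkin_op //.
  (* At the empty word both sides vanish, as [grading_inv] does there. *)
  have [w0|w0] := posnP (wdeg deg w); last by rewrite mulKf // pnatr_eq0 -lt0n.
  move/eqP: w0; rewrite wdeg_eq0 // => /eqP ->.
  by rewrite wdeg_nil invr0 mul0r; case: alpha_g.
split=> [w|deg_fin m]; first exact: pullback_term_Bterm.
exact: pullback_Bseries.
Qed.
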